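(* Let $T$ be a tree with $n$ vertices and matching number $\beta$. (i) If $0\leq \alpha< \frac{1}{2}$, then $$S_k(A_{\alpha}(T))\leq \begin{cases} \alpha(n+2k-2)+(1-2\alpha)\sqrt{k(n-1)}, & \text{if } 1\leq k \leq \beta;\\ \alpha(n+2k-2)+(1-2\alpha)\sqrt{\beta (n-1)}, & \text{if } \beta< k \leq n-\beta;\\ \alpha(n+2k-2)+(1-2\alpha)\sqrt{(n-k)(n-1)}, & \text{if } n-\beta< k \leq n. \end{cases}$$ (ii) If $\frac{1}{2} \leq \alpha<1$, then $S_k(A_{\alpha}(T))\leq \alpha(n+2k-2)$ for $1\leq k \leq n$.
   Context: $A_{\alpha}(G)=\alpha D(G)+(1-\alpha)A(G)$, where $A(G)$ is the adjacency matrix and $D(G)$ the diagonal degree matrix. For a real symmetric matrix $M$ with eigenvalues $\lambda_1(M)\geq\cdots\geq\lambda_n(M)$, $S_k(M)=\sum_{i=1}^k\lambda_i(M)$. The matching number is the maximum number of edges in a matching (set of pairwise disjoint edges). *)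

(* Defs.v *)
From HB Require Import structures.
From mathcomp Require Import all_boot all_order all_algebra.
Set Implicit Arguments. Unset Strict Implicit. Unset Printing Implicit Defensive.
Import Order.TTheory GRing.Theory Num.Theory.
Local Open Scope ring_scope.

Definition simple_graph (n : nat) (e : rel 'I_n) : Prop :=
  symmetric e /\ irreflexive e.

Definition is_tree (n : nat) (e : rel 'I_n) : Prop :=
  (0 < n)%N /\
  (forall x y : 'I_n, connect e x y) /\
  (forall s : seq 'I_n, uniq s -> (2 < size s)%N -> ~~ cycle e s).

Definition is_matching (n : nat) (e : rel 'I_n) (M : {set {set 'I_n}}) : bool :=
  [forall E in M, [exists x, exists y, e x y && (E == [set x; y])]]
  && trivIset M.

Definition matching_number (n : nat) (e : rel 'I_n) : nat :=
  \max_(M : {set {set 'I_n}} | is_matching e M) #|M|.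

Definition adj_mx (R : nzRingType) (n : nat) (e : rel 'I_n) : 'M[R]_n :=
  \matrix_(i, j) (e i j)%:R.

Definition deg (n : nat) (e : rel 'I_n) (i : 'I_n) : nat := #|[set j | e i j]|.

Definition deg_mx (R : nzRingType) (n : nat) (e : rel 'I_n) : 'M[R]_n :=
  \matrix_(i, j) ((i == j)%:R * (deg e i)%:R).

Definition A_alpha (R : comNzRingType) (n : nat) (e : rel 'I_n) (alpha : R)
  : 'M[R]_n :=
  alpha *: deg_mx R e + (1 - alpha) *: adj_mx R e.

Definition is_spectrum (R : realDomainType) (n : nat) (M : 'M[R]_n)
  (s : seq R) : Prop :=
  sorted (fun x y => y <= x) s /\
  char_poly M = \prod_(x <- s) ('X - x%:P).

(* S_k = sum of the k largest eigenvalues. *)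
Definition Sk (R : realDomainType) (s : seq R) (k : nat) : R :=
  \sum_(i < k) s`_i.

(* Main.v *)
Require Import Defs.
From HB Require Import structures.
From mathcomp Require Import all_boot all_order all_algebra.
From mathcomp Require Import fingroup perm complex ring lra.
Import Order.TTheory GRing.Theory Num.Theory.
Local Open Scope ring_scope.
Set Implicit Arguments. Unset Strict Implicit. Unset Printing Implicit Defensive.

(* The sum of [k] eigenvalues of a symmetric matrix [B] is [\tr (M B)] for an
   orthogonal projection [M] of trace [k].  Such traces are linear in [B], and
   [A_alpha] is [alpha (D + A) + (1 - 2 alpha) A], as well as
   [(1 - alpha) (D + A) + (2 alpha - 1) D], so it suffices to bound
   [\tr (M (D + A))], [\tr (M D)] and [\tr (M A)] separately.

   If [u] is a unit eigenvector of [D + A] for [l], Cauchy-Schwarz on each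
   neighbourhood gives [l u D^-1 u^T <= 2], that is,
   [l - 2 <= l u (1 - D^-1) u^T].  The right-hand sides are nonnegative and sum,
   over an eigenbasis, to [\sum_v (deg v - 1)], which is [n - 2] for a tree.

   For [A], bipartiteness gives [\tr (M A)^2 <= (n - 1) \tr M]; this also applies
   to [1 - M], because [\tr A = 0].  Finally [|\tr (M A)|] is at most half the
   energy of [A], which is controlled by [\tr (A^2)] and by
   [\rank A <= 2 beta]: in a bipartite graph, a nonzero minor of the
   biadjacency matrix exhibits a matching. *)

(** * Spectral theorem for real symmetric matrices *)

(** Lagrange's identity: twice the difference of the two sides is the double sum of the squares
    [(a i * b j - a j * b i) ^+ 2]. *)
Lemma cauchy_schwarz_sum (R : realDomainType) (I : finType) (a b : I -> R) :
  (\sum_i a i * b i) ^+ 2 <= (\sum_i a i ^+ 2) * (\sum_i b i ^+ 2).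
Proof.
rewrite -subr_ge0.
have : 0 <= \sum_i \sum_j (a i * b j - a j * b i) ^+ 2.
  by apply: sumr_ge0 => i _; apply: sumr_ge0 => j _; apply: sqr_ge0.
suff -> : \sum_i \sum_j (a i * b j - a j * b i) ^+ 2 =
  ((\sum_i a i ^+ 2) * (\sum_i b i ^+ 2) - (\sum_i a i * b i) ^+ 2) *+ 2.
  by rewrite pmulrn_lge0.
have prodE (f g : I -> R) :
    (\sum_i f i) * (\sum_j g j) = \sum_i \sum_j f i * g j.
  by rewrite mulr_suml; apply: eq_bigr => i _; rewrite mulr_sumr.
rewrite mulr2n {2}[(\sum_i a i ^+ 2) * _]mulrC expr2 !prodE -!sumrB -big_split.
apply: eq_bigr => i _; rewrite -!sumrB -big_split /=.
by apply: eq_bigr => j _; ring.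
Qed.

Section Spectral.
Variable R : rcfType.

Lemma row_norm_gt0 n (u : 'rV[R]_n) : u != 0 -> 0 < (u *m u^T) 0 0.
Proof.
move=> u0; have [j uj0] : exists j, u 0 j != 0.
  apply/existsP; rewrite -negb_forall; apply: contra u0 => /forallP u0.
  by apply/eqP/rowP => j; rewrite mxE; apply/eqP.
rewrite mxE (bigD1 j) //= mxE ltr_wpDr ?sumr_ge0 // => [k _|].
  by rewrite mxE -expr2 sqr_ge0.
by rewrite -expr2 lt0r sqrf_eq0 uj0 sqr_ge0.
Qed.

(* A nonzero real or imaginary part of a complex eigenvector is an eigenvector,
   the eigenvalue being real by symmetry. *)
Lemma symmetric_has_eigenvalue n (B : 'M[R]_n.+1) :
  B^T = B -> exists a, eigenvalue B a.
Proof.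
move=> symB.
have [a /eigenvalueP[v vB v0]] :=
  eigenvalue_closed (map_mx (real_complex R) B) (ltn0Sn n).
pose x := map_mx (@complex.Re R) v; pose y := map_mx (@complex.Im R) v.
have xB : x *m B = complex.Re a *: x - complex.Im a *: y.
  apply/rowP => j; have /rowP/(_ j)/(congr1 (@complex.Re R)) := vB.
  rewrite !mxE raddf_sum; case: (a) (v 0 j) => [a1 a2] [v1 v2] /= <-.
  apply: eq_bigr => i _; rewrite !mxE.
  by case: (v 0 i) => v1' v2' /=; rewrite mulr0 subr0.
have yB : y *m B = complex.Im a *: x + complex.Re a *: y.
  apply/rowP => j; have /rowP/(_ j)/(congr1 (@complex.Im R)) := vB.
  rewrite !mxE raddf_sum; case: (a) (v 0 j) => [a1 a2] [v1 v2] /=.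
  rewrite addrC => <-.
  apply: eq_bigr => i _; rewrite !mxE.
  by case: (v 0 i) => v1' v2' /=; rewrite mulr0 add0r.
have xy0 : (x != 0) || (y != 0).
  apply: contraR v0; rewrite negb_or !negbK => /andP[/eqP x0 /eqP y0].
  apply/eqP/rowP => j; move/rowP/(_ j): x0; move/rowP/(_ j): y0.
  by rewrite !mxE; case: (v 0 j) => /= v1 v2 -> ->.
have ge0 (u : 'rV[R]_n.+1) : 0 <= (u *m u^T) 0 0.
  by have [->|/row_norm_gt0/ltW//] := eqVneq u 0; rewrite mul0mx mxE.
have Ima0 : complex.Im a = 0.
  have xyC : (x *m y^T) 0 0 = (y *m x^T) 0 0.
    by rewrite -[y in RHS]trmxK -trmx_mul [RHS]mxE.
  (* Expanding both sides cancels [Re a] and leaves [Im a * (|x|^2 + |y|^2) = 0]. *)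
  have : (x *m B *m y^T) 0 0 = (y *m B *m x^T) 0 0.
    by rewrite -[y in RHS]trmxK -{2}symB -!trmx_mul mulmxA [RHS]mxE.
  rewrite xB yB mulmxBl mulmxDl -!scalemxAl.
  rewrite ![((_ : 'M_1) + _) 0 0]mxE ![(- (_ : 'M_1)) 0 0]mxE ![(_ *: (_ : 'M_1)) 0 0]mxE xyC => h.
  have : complex.Im a * ((x *m x^T) 0 0 + (y *m y^T) 0 0) = 0.
    by apply/eqP; rewrite mulrDr -[_ * _]opprK; apply/eqP; lra.
  move/eqP; rewrite mulf_eq0 => /orP[/eqP//|].
  by rewrite paddr_eq0 // => /andP[/eqP x0 /eqP y0]; case/orP: xy0 => /row_norm_gt0;
    rewrite ?x0 ?y0 ltxx.
exists (complex.Re a); apply/eigenvalueP; case/orP: xy0 => nz.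
  by exists x => //; rewrite xB Ima0 scale0r subr0.
by exists y => //; rewrite yB Ima0 scale0r add0r.
Qed.

(** The reflection in the hyperplane orthogonal to [u - v] exchanges two vectors of equal norm. *)
Lemma householder n (u v : 'rV[R]_n) : u *m u^T = v *m v^T ->
  exists H : 'M[R]_n, [/\ H^T = H, H *m H = 1%:M & u *m H = v].
Proof.
move=> uv; have [->|neq_uv] := eqVneq u v.
  by exists 1%:M; rewrite trmx1 mul1mx mulmx1.
set w := u - v; set c := (w *m w^T) 0 0.
have c0 : c != 0 by rewrite gt_eqF // row_norm_gt0 // subr_eq0.
have wwc : w *m w^T = c%:M by rewrite [LHS]mx11_scalar.
have uw : u *m w^T = (c / 2)%:M.
  rewrite [LHS]mx11_scalar; congr _%:M; rewrite /c /w linearB /=.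
  have uvC : (u *m v^T) 0 0 = (v *m u^T) 0 0.
    by rewrite -[u in LHS]trmxK -trmx_mul mxE.
  rewrite mulmxBl !mulmxBr uv.
  rewrite ![((_ : 'M_1) + _) 0 0]mxE ![(- (_ : 'M_1)) 0 0]mxE.
  rewrite ![((_ : 'M_1) + _) 0 0]mxE ![(- (_ : 'M_1)) 0 0]mxE uvC.
  by field.
set t := 2 / c; set Z := w^T *m w.
have ZZ : Z *m Z = c *: Z.
  by rewrite /Z mulmxA -(mulmxA w^T) wwc mul_mx_scalar -scalemxAl.
exists (1%:M - t *: Z); split.
- by rewrite linearB /= trmx1 linearZ /= trmx_mul trmxK.
- rewrite mulmxBl mul1mx mulmxBr mulmx1 -scalemxAl -scalemxAr ZZ !scalerA.
  have -> : t * t * c = t + t by rewrite /t; field.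
  by rewrite scalerDl opprB addrK subrK.
- rewrite mulmxBr mulmx1 -scalemxAr mulmxA uw mul_scalar_mx scalerA.
  have -> : t * (c / 2) = 1 by rewrite /t; field.
  by rewrite scale1r /w subKr.
Qed.

(** Induction on the size: a reflection sends a unit eigenvector to the first basis vector, and
    conjugating by it splits off a 1 by 1 block. *)
Theorem symmetric_diagonalization n (B : 'M[R]_n) : B^T = B ->
  exists (P : 'M[R]_n) (d : 'rV[R]_n),
    P *m P^T = 1%:M /\ B = P^T *m diag_mx d *m P.
Proof.
elim: n B => [|n IHn] B symB.
  by exists 1%:M, 0; split; [rewrite mul1mx trmx1 | apply/matrixP => -[]].
have [a /eigenvalueP[v vB v0]] := symmetric_has_eigenvalue symB.
have nv := row_norm_gt0 v0; set c := (v *m v^T) 0 0 in nv.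
pose e0 : 'rV[R]_(1 + n) := delta_mx 0 0.
pose u := (Num.sqrt c)^-1 *: v.
have uB : u *m B = a *: u by rewrite -scalemxAl vB !scalerA mulrC.
have uu : u *m u^T = e0 *m e0^T.
  rewrite linearZ /= -scalemxAl -scalemxAr scalerA [v *m _]mx11_scalar -/c.
  rewrite trmx_delta mul_delta_mx scale_scalar_mx -expr2 exprVn.
  rewrite sqr_sqrtr ?ltW // mulVf ?gt_eqF //.
  by apply/matrixP => i j; rewrite !ord1 !mxE !eqxx.
have [H [symH HH uH]] := householder uu.
pose K : 'M[R]_(1 + n) := H *m B *m H.
have symK : K^T = K by rewrite /K !trmx_mul symH symB mulmxA.
have eK : e0 *m K = a *: e0.
  by rewrite /K !mulmxA -{1}uH -(mulmxA u) HH mulmx1 uB -scalemxAl uH.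
have -> : B = H *m K *m H.
  by rewrite /K !mulmxA HH mul1mx -mulmxA HH mulmx1.
clearbody K; have K0 j : K 0 j = a *+ (j == 0).
  move/rowP/(_ j): eK; rewrite -rowE !mxE eqxx /= => ->.
  by rewrite mulr_natr.
have Kblock : K = block_mx a%:M 0 0 (drsubmx K).
  rewrite -[LHS]submxK; congr block_mx; apply/matrixP => i j; rewrite !ord1 !mxE.
  - by rewrite eqxx -[RHS](K0 0); congr (K _ _); apply: val_inj.
  - by rewrite -[RHS](mulr0n a) -(K0 (rshift 1 j)); congr (K _ _); apply: val_inj.
  - by rewrite -symK mxE -[RHS](mulr0n a) -(K0 (rshift 1 i)); congr (K _ _); apply: val_inj.
have [|P [d [PP Kd]]] := IHn (drsubmx K).
  by rewrite trmx_drsub symK.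
pose P' : 'M[R]_(1 + n) := block_mx 1%:M 0 0 P.
have P'T : P'^T = block_mx 1%:M 0 0 P^T.
  by rewrite tr_block_mx !trmx0 trmx1.
have P'P : P' *m P'^T = 1%:M.
  rewrite P'T mulmx_block !mulmx0 !mul0mx !addr0 add0r mulmx1 PP.
  by rewrite -scalar_mx_block.
have dE : diag_mx (row_mx a%:M d : 'rV_(1 + n)) = block_mx a%:M 0 0 (diag_mx d).
  by rewrite diag_mx_row; congr block_mx; apply/matrixP => i j; rewrite !ord1 !mxE.
have K_E : K = P'^T *m block_mx a%:M 0 0 (diag_mx d) *m P'.
  rewrite Kblock {1}Kd P'T !mulmx_block.
  by rewrite !(mulmx0, mul0mx, addr0, add0r, mulmx1, mul1mx).
exists (P' *m H), (row_mx a%:M d); split.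
  by rewrite trmx_mul symH mulmxA -(mulmxA P') HH mulmx1.
by rewrite trmx_mul symH dE {1}K_E !mulmxA.
Qed.
End Spectral.

(** * Orthogonal projections *)

Definition orth_proj (R : pzRingType) n (M : 'M[R]_n) : Prop :=
  M^T = M /\ M *m M = M.

Section OrthogonalProjections.
Variable R : realDomainType.
Implicit Types (n : nat).

Lemma orth_proj_compl n (M : 'M[R]_n) : orth_proj M -> orth_proj (1%:M - M).
Proof.
move=> [symM MM]; split; first by rewrite linearB /= trmx1 symM.
by rewrite mulmxBl mul1mx mulmxBr mulmx1 MM subrr subr0.
Qed.

Lemma orth_proj_conj n (P M : 'M[R]_n) :
  P *m P^T = 1%:M -> orth_proj M -> orth_proj (P *m M *m P^T).
Proof.
move=> /mulmx1C PP [symM MM]; split; first by rewrite !trmx_mul trmxK symM mulmxA.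
by rewrite !mulmxA -(mulmxA _ P^T P) PP mulmx1 -(mulmxA P M M) MM.
Qed.

Lemma orth_proj_diagE n (M : 'M[R]_n) i :
  orth_proj M -> M i i = \sum_j M i j ^+ 2.
Proof.
move=> [symM MM]; rewrite -{1}MM mxE; apply: eq_bigr => j _.
by rewrite -{2}symM mxE.
Qed.

Lemma orth_proj_diag_ge0 n (M : 'M[R]_n) i : orth_proj M -> 0 <= M i i.
Proof. by move=> /orth_proj_diagE ->; apply: sumr_ge0 => j _; apply: sqr_ge0. Qed.

Lemma orth_proj_diag_le1 n (M : 'M[R]_n) i : orth_proj M -> M i i <= 1.
Proof.
move=> /orth_proj_compl/(orth_proj_diag_ge0 i).
by rewrite !mxE eqxx subr_ge0.
Qed.

Lemma orth_proj_trace n (M : 'M[R]_n) :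
  orth_proj M -> \tr M = \sum_i \sum_j M i j ^+ 2.
Proof. by move=> pM; apply: eq_bigr => i _; apply: orth_proj_diagE. Qed.

Lemma mxtrace_diagonalized n (M P : 'M[R]_n) (d : 'rV[R]_n) :
  \tr (M *m (P^T *m diag_mx d *m P)) = \sum_i d 0 i * (P *m M *m P^T) i i.
Proof.
rewrite !mulmxA mxtrace_mulC !mulmxA; apply: eq_bigr => i _.
by rewrite mul_mx_diag mxE mulrC.
Qed.

Lemma mxtrace_conj n (M P : 'M[R]_n) :
  P *m P^T = 1%:M -> \tr (P *m M *m P^T) = \tr M.
Proof. by move=> /mulmx1C PP; rewrite mxtrace_mulC mulmxA PP mul1mx. Qed.

Lemma char_poly_diagonalized n (P : 'M[R]_n) (d : 'rV[R]_n) :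
  P *m P^T = 1%:M ->
  char_poly (P^T *m diag_mx d *m P) = \prod_i ('X - (d 0 i)%:P).
Proof.
move=> /mulmx1C PP; transitivity (char_poly (diag_mx d)); last first.
  rewrite char_poly_trig ?diag_mx_is_trig //.
  by apply: eq_bigr => i _; rewrite mxE eqxx mulr1n.
have PPX : map_mx polyC P^T *m map_mx polyC P = 1%:M by rewrite -map_mxM PP map_mx1.
rewrite /char_poly /char_poly_mx.
have -> : 'X%:M - map_mx polyC (P^T *m diag_mx d *m P) =
    map_mx polyC P^T *m ('X%:M - map_mx polyC (diag_mx d)) *m map_mx polyC P.
  rewrite mulmxBr mulmxBl !map_mxM; congr (_ - _).
  by rewrite mul_mx_scalar -scalemxAl PPX -mul_scalar_mx mulmx1.
by rewrite !det_mulmx mulrAC -det_mulmx PPX det1 mul1r.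
Qed.
End OrthogonalProjections.

(* Ky Fan: the sum is attained by the projection onto the span of the
   corresponding eigenvectors.  This holds for any ordering of [s]. *)
Lemma Sk_orth_proj (R : rcfType) n (B : 'M[R]_n) (s : seq R) k :
  B^T = B -> char_poly B = \prod_(x <- s) ('X - x%:P) -> (k <= n)%N ->
  exists M : 'M[R]_n, [/\ orth_proj M, \tr M = k%:R & Sk s k = \tr (M *m B)].
Proof.
move=> symB chB le_kn.
have [P [d [PP Bd]]] := symmetric_diagonalization symB.
have : perm_eq s [tuple d 0 i | i < n].
  apply: prod_XsubC_eq; rewrite -chB {1}Bd char_poly_diagonalized //.
  by rewrite big_tuple; apply: eq_bigr => i _; rewrite tnth_mktuple.
move=> /tuple_permP[p sE].
have s_nth (i : 'I_n) : s`_i = d 0 (p i).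
  by rewrite sE (nth_map i) ?size_enum_ord // nth_ord_enum tnth_mktuple.
(* [p] sends an index of [s] to a position of the same eigenvalue in [d], so [D] selects the
   positions of the first [k] entries of [s]. *)
pose D : 'M[R]_n := diag_mx (\row_i (p^-1%g i < k)%N%:R).
have DE i j : D i j = (p^-1%g i < k)%N%:R *+ (i == j) by rewrite !mxE.
have pD : orth_proj D.
  split; first by rewrite tr_diag_mx.
  rewrite mulmx_diag; congr diag_mx; apply/rowP => i; rewrite !mxE.
  by case: (_ < _)%N; rewrite !(mulr0, mulr1).
have PPT : P^T *m P^T^T = 1%:M by rewrite trmxK (mulmx1C PP).
exists (P^T *m D *m P^T^T); split.
- exact: orth_proj_conj.
- rewrite mxtrace_conj // /mxtrace (reindex_inj (@perm_inj _ p)) /=.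
  under eq_bigr do rewrite DE permK eqxx mulr1n.
  transitivity (\sum_(i < n | (i < k)%N) (1 : R)).
    by rewrite [RHS]big_mkcond; apply: eq_bigr => i _; case: ifP.
  by rewrite -(big_ord_widen n (fun=> 1)) // sumr_const card_ord.
- rewrite Bd mxtrace_diagonalized trmxK !mulmxA PP mul1mx -mulmxA PP mulmx1.
  rewrite (reindex_inj (@perm_inj _ p)) /= /Sk (big_ord_widen n (fun i => s`_i)) //.
  rewrite big_mkcond /=; apply: eq_bigr => i _.
  by rewrite DE permK eqxx mulr1n s_nth; case: ifP; rewrite (mulr1, mulr0).
Qed.

(** * Matchings and the rank of the adjacency matrix *)

(** The rows indexed by the support are free: inverting their diagonal entries gives a right
    inverse. *)
Lemma card_support_le_rank_diag (F : fieldType) n (d : 'rV[F]_n) :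
  (#|[pred i | d 0%R i != 0%R]| <= \rank (diag_mx d))%N.
Proof.
set S := [pred i | _]; pose f (i : 'I_#|S|) : 'I_n := enum_val i.
have free_f : row_free (rowsub f (diag_mx d)).
  apply/row_freeP; exists (colsub f (diag_mx (\row_i (d 0 i)^-1))).
  rewrite -mxsub_mul mulmx_diag; apply/matrixP => i j.
  rewrite !mxE (inj_eq enum_val_inj) divff //.
  by have := enum_valP i; rewrite inE.
by rewrite -(eqP free_f); apply: mxrankS; apply: rowsub_sub.
Qed.

Section MatchingRank.
Variables (n : nat) (e : rel 'I_n) (c : pred 'I_n).

(** A nonzero minor of size [\rank B] has a nonzero term in its Leibniz expansion. This term pairs
    rows with columns along edges, and the pairs are disjoint because the row vertices satisfy [c]
    and the column vertices do not. *)
Lemma rank_oriented_le_matching (F : fieldType) (B : 'M[F]_n) :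
  (forall i j, B i j != 0 -> [&& e i j, c i & ~~ c j]) ->
  (\rank B <= matching_number e)%N.
Proof.
move=> suppB; set r := \rank B.
pose f := maxrankfun B.
have fullC : row_full (rowsub f B)^T.
  by rewrite /row_full mxrank_tr; apply: maxrowsub_free.
pose g := fullrankfun fullC.
have : \det (rowsub g (rowsub f B)^T) != 0.
  by rewrite -unitfE -unitmxE; apply: fullrowsub_unit.
have [s Ps | noS] := pickP (fun s : 'S_r => [forall i, B (f (s i)) (g i) != 0]); last first.
  rewrite /determinant big1 ?eqxx // => s _.
  have /negbT := noS s; rewrite negb_forall => /existsP[j]; rewrite negbK => /eqP Bj0.
  by rewrite (bigD1 j) //= !mxE Bj0 mul0r mulr0.
move=> _; have {}Ps i : [&& e (f (s i)) (g i), c (f (s i)) & ~~ c (g i)].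
  exact/suppB/(forallP Ps).
pose E i := [set f (s i); g i].
have disjE i j : i != j -> [disjoint E i & E j].
  move=> ij; apply/pred0P => x; rewrite /= !inE; apply/negP.
  have /and3P[_ ci ci'] := Ps i; have /and3P[_ cj cj'] := Ps j.
  case/andP => /orP[] /eqP -> /orP[] /eqP h.
  - by move/maxrankfun_inj/perm_inj: h => h; rewrite h eqxx in ij.
  - by rewrite -h ci in cj'.
  - by rewrite -h (negPf ci') in cj.
  - by move/fullrankfun_inj: h => h; rewrite h eqxx in ij.
have injE : injective E.
  move=> i j Eij; apply/eqP; apply: contraT => /disjE/pred0P/(_ (g i)).
  by rewrite /= -Eij !inE eqxx orbT.
apply: leq_trans (leq_bigmax_cond _ (_ : is_matching e [set E i | i : 'I_r])).
  by rewrite card_imset // card_ord.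
apply/andP; split.
  apply/forall_inP => _ /imsetP[i _ ->].
  apply/existsP; exists (f (s i)); apply/existsP; exists (g i).
  by have /andP[-> _] := Ps i; rewrite eqxx.
apply/trivIsetP => _ _ /imsetP[i _ ->] /imsetP[j _ ->] neqE.
by apply: disjE; apply: contraNneq neqE => ->.
Qed.

(** Orienting each edge away from its end in [c] splits the adjacency matrix as [B + B^T], and rank
    is subadditive. *)
Lemma rank_adj_le_matching (F : fieldType) :
  symmetric e -> (forall i j, e i j -> c i != c j) ->
  (\rank (adj_mx F e) <= 2 * matching_number e)%N.
Proof.
move=> sym_e proper_c.
pose B : 'M[F]_n := \matrix_(i, j) (e i j && c i)%:R.
have -> : adj_mx F e = B + B^T.
  apply/matrixP => i j; rewrite !mxE (sym_e j i).
  case eij: (e i j) => /=; last by rewrite addr0.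
  by have := proper_c _ _ eij; case: (c i) (c j) => [] [] //= _; rewrite ?addr0 ?add0r.
apply: leq_trans (mxrank_add _ _) _; rewrite mxrank_tr addnn -mul2n leq_mul2l /=.
apply: rank_oriented_le_matching => i j; rewrite mxE.
case eij: (e i j) => /=; last by rewrite eqxx.
by have := proper_c _ _ eij; case: (c i) (c j) => [] []; rewrite ?eqxx.
Qed.
End MatchingRank.

(** * Trees *)

Section TreeDepth.
Variables (n : nat) (e : rel 'I_n).
Hypotheses (simple_e : simple_graph e) (tree_e : is_tree e).

(** A duplicate-free [e']-path from [x] to [y], closed by the edge [x y], would be a cycle of
    [e]. *)
Lemma tree_edge_is_bridge x y (e' : rel 'I_n) :
  subrel e' e -> ~~ e' x y -> e x y -> ~~ connect e' x y.
Proof.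
have [sym_e irr_e] := simple_e; have [_ [_ acyclic_e]] := tree_e.
move=> sub_e' not_e' exy; apply/negP => /connectP[p pth lastE].
case: (shortenP pth) lastE => q pth_q uniq_q _ lastE.
(* A shorter path would mean [x = y], or be the step [x y] that [e'] lacks. *)
have : (2 < size (x :: q))%N.
  case: q pth_q lastE {uniq_q} => [|z [|//]] /=.
    by move=> _ yx; rewrite yx irr_e in exy.
  by rewrite andbT => e'xz yz; rewrite yz e'xz in not_e'.
move=> /(acyclic_e _ uniq_q)/negP[].
rewrite /= rcons_path -lastE sym_e exy andbT.
exact: sub_path pth_q.
Qed.

(** [h] is the distance to [r] and [p] picks a neighbour nearer to [r]. An edge joining no vertex to
    its parent could be deleted with every vertex still connected to [r], although every edge is a
    bridge. *)
Lemma tree_has_parent_structure (r : 'I_n) :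
  exists (h : 'I_n -> nat) (p : 'I_n -> 'I_n),
    h r = 0%N /\
    (forall x y, e x y -> (h x == (h y).+1) && (y == p x) ||
                          (h y == (h x).+1) && (x == p y)).
Proof.
have [sym_e irr_e] := simple_e; have [_ [conn_e _]] := tree_e.
pose walk x m := [exists t : m.-tuple 'I_n, path e r t && (last r t == x)].
have walk_ex x : exists m, walk x m.
  have /connectP[t pth ->] := conn_e r x.
  by exists (size t); apply/existsP; exists (in_tuple t); rewrite pth eqxx.
pose h x := ex_minn (walk_ex x).
have h_walk x : walk x (h x) by rewrite /h; case: ex_minnP.
have h_min x m : walk x m -> (h x <= m)%N by rewrite /h; case: ex_minnP => ? _; apply.
have hr : h r = 0%N.
  apply/eqP; rewrite -leqn0; apply: h_min; apply/existsP; exists [tuple].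
  by rewrite /= eqxx.
have walkS x y m : walk x m -> e x y -> walk y m.+1.
  move=> /existsP[t /andP[pth /eqP lastE]] exy.
  apply/existsP; exists [tuple of rcons t y].
  by rewrite rcons_path pth lastE exy last_rcons eqxx.
have parent_ex x : x != r -> exists z, e x z && (h x == (h z).+1).
  move=> xr; have /existsP[t /andP[pth /eqP lastE]] := h_walk x.
  case: (lastP t) (size_tuple t) pth lastE => [|t' z] size_t /=.
    by move=> _ rx; rewrite rx eqxx in xr.
  rewrite rcons_path last_rcons size_rcons in size_t * => /andP[pth ez] zx.
  rewrite zx {z zx} in ez.
  have walk_z : walk (last r t') (size t').
    by apply/existsP; exists (in_tuple t'); rewrite pth eqxx.
  exists (last r t'); rewrite sym_e ez /= eqn_leq.
  rewrite (h_min _ _ (walkS _ _ _ (h_walk _) ez)) -size_t ltnS.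
  exact: h_min.
(* No neighbour of [r] is nearer, so the default makes [r] its own parent. *)
pose p x := odflt r [pick z | e x z && (h x == (h z).+1)].
have pP x : x != r -> e x (p x) && (h x == (h (p x)).+1).
  move=> xr; rewrite /p; case: pickP => [//|none].
  by have [z] := parent_ex x xr; rewrite none.
exists h, p; split=> // x y exy; apply: contraT.
rewrite negb_or => /andP[not_xy not_yx].
pose e' := [rel a b | e a b && ~~ ((a == x) && (b == y) || (a == y) && (b == x))].
have sym_e' : symmetric e'.
  by move=> a b /=; rewrite sym_e ![in RHS](andbC (b == _)) orbC.
(* Steps to the parent avoid the deleted edge; the induction is on the depth. *)
have to_root z : connect e' z r.
  elim: {z}(h z) {-2}z (erefl (h z)) => [|m IHm] z hz.
    have [->//|/pP/andP[_ /eqP]] := eqVneq z r.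
    by rewrite hz.
  have [->//|zr] := eqVneq z r.
  have /andP[ez hpz] := pP z zr.
  apply: connect_trans (IHm (p z) _); last by apply/eqP; rewrite -eqSS -hz eq_sym.
  apply: connect1; rewrite /= ez /=; apply/negP => /orP[] /andP[/eqP zE /eqP pzE].
    by move: not_xy; rewrite -zE -pzE hpz eqxx.
  by move: not_yx; rewrite -zE -pzE hpz eqxx.
have /negP[] : ~~ connect e' x y.
  apply: (tree_edge_is_bridge _ _ exy) => [a b /= /andP[]//|/=].
  by rewrite !eqxx andbF.
apply: connect_trans (to_root x) _.
by rewrite (sym_connect_sym sym_e').
Qed.

Lemma tree_bipartite : exists c : pred 'I_n, forall i j, e i j -> c i != c j.
Proof.
have [n0 _] := tree_e.
have [h [p [_ hp]]] := tree_has_parent_structure (Ordinal n0).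
exists (fun i => odd (h i)) => i j /hp /orP[] /andP[/eqP -> _] /=.
  by case: (odd _).
by case: (odd _).
Qed.

(** Each edge goes up in one of its two directions, and only the vertices other than the root have
    an upward edge, at most one each. *)
Lemma tree_sum_deg : (\sum_i deg e i <= 2 * (n - 1))%N.
Proof.
have [n0 _] := tree_e; pose r := Ordinal n0.
have [h [p [hr hp]]] := tree_has_parent_structure r.
pose up i j := (h i == (h j).+1) && (j == p i).
have degE i : deg e i = (\sum_j e i j)%N.
  rewrite /deg -sum1_card [LHS]big_mkcond; apply: eq_bigr => j _.
  by rewrite inE; case: (e i j).
apply: (@leq_trans (\sum_i \sum_j (up i j + up j i))%N).
  apply: leq_sum => i _; rewrite degE; apply: leq_sum => j _.
  by case: (boolP (e i j)) => // /hp; rewrite -/(up i j) -/(up j i); case: (up i j) (up j i) => [] [].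
have upE : (\sum_i \sum_j up i j <= n - 1)%N.
  have -> : (n - 1 = \sum_(i | i != r) 1)%N.
    by rewrite sum1_card cardC1 card_ord subn1.
  rewrite [leqRHS]big_mkcond; apply: leq_sum => i _.
  case: eqVneq => [->|_].
    by rewrite big1 // => j _; rewrite /up hr.
  rewrite (bigD1 (p i)) //= big1 ?addn0 ?leq_b1 // => j /negPf jp.
  by rewrite /up jp andbF.
under eq_bigr do rewrite big_split.
rewrite big_split /= mul2n -addnn leq_add // exchange_big //.
Qed.

Lemma tree_deg_gt0 i : (1 < n)%N -> (0 < deg e i)%N.
Proof.
move=> n1; have [_ [conn_e _]] := tree_e.
have [j ji] : exists j : 'I_n, j != i.
  apply/existsP; rewrite -negb_forall; apply/negP => /forallP all_i.
  have := eqP (all_i (Ordinal n1)).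
  by rewrite -(eqP (all_i (Ordinal (ltnW n1)))).
have /connectP[[|k p] /= pth jE] := conn_e i j; first by rewrite jE eqxx in ji.
by have /andP[eik _] := pth; apply/card_gt0P; exists k; rewrite inE.
Qed.
End TreeDepth.

(** * Trace inequalities *)

(** As [\tr B = 0], the weights [m i] in [[0, 1]] may be lowered by 1/2, which bounds their squares
    by 1/4. At most [\rank B] eigenvalues are nonzero, and Cauchy-Schwarz concludes. *)
Lemma trace_sq_le_rank (R : rcfType) n (B M : 'M[R]_n) :
  B^T = B -> \tr B = 0 -> orth_proj M ->
  4 * \tr (M *m B) ^+ 2 <= (\rank B)%:R * \tr (B *m B).
Proof.
move=> symB trB0 pM; have [P [d [PP Bd]]] := symmetric_diagonalization symB.
set m := fun i => (P *m M *m P^T) i i.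
have pPM := orth_proj_conj PP pM.
have diagB : diag_mx d = P *m B *m P^T.
  by rewrite Bd !mulmxA PP mul1mx -mulmxA PP mulmx1.
have sum_d : \sum_i d 0 i = 0.
  by rewrite -mxtrace_diag diagB mxtrace_conj.
have sum_d2 : \sum_i d 0 i ^+ 2 = \tr (B *m B).
  rewrite -(mxtrace_conj _ PP).
  have -> : P *m (B *m B) *m P^T = diag_mx d *m diag_mx d.
    by rewrite diagB !mulmxA -(mulmxA _ P^T) (mulmx1C PP) mulmx1.
  by rewrite mulmx_diag mxtrace_diag; apply: eq_bigr => i _; rewrite mxE.
pose w i := if d 0 i != 0 then m i - 2^-1 else 0.
have -> : \tr (M *m B) = \sum_i d 0 i * w i.
  rewrite Bd mxtrace_diagonalized.
  have half_d : \sum_i d 0 i / 2 = 0 by rewrite -mulr_suml sum_d mul0r.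
  rewrite -[LHS]subr0 -[X in _ - X]half_d -sumrB.
  apply: eq_bigr => i _; rewrite -mulrBr /w.
  by case: eqP => [->|//]; rewrite !mul0r.
have sum_w : 4 * (\sum_i w i ^+ 2) <= (\rank B)%:R.
  have le_rank : (#|[pred i | d 0%R i != 0%R]| <= \rank B)%N.
    apply: leq_trans (card_support_le_rank_diag d) _.
    by rewrite diagB; apply: leq_trans (mxrankM_maxl _ _) (mxrankM_maxr _ _).
  rewrite mulr_sumr; apply: le_trans (_ : _ <= #|[pred i | d 0 i != 0]|%:R) _.
    rewrite -sumr_const [leRHS]big_mkcond; apply: ler_sum => i _; rewrite /w inE.
    case: ifP => _; last by rewrite expr0n mulr0.
    have := orth_proj_diag_ge0 i pPM; have := orth_proj_diag_le1 i pPM.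
    by rewrite -/(m i); nra.
  by rewrite ler_nat.
rewrite -sum_d2; have cs := cauchy_schwarz_sum (fun i => d 0 i) w.
apply: le_trans (_ : _ <= 4 * ((\sum_i d 0 i ^+ 2) * (\sum_i w i ^+ 2))) _.
  by rewrite ler_wpM2l.
rewrite mulrCA mulrC ler_wpM2r //.
by apply: sumr_ge0 => i _; apply: sqr_ge0.
Qed.

Section GraphMatrices.
Variables (R : rcfType) (n : nat) (e : rel 'I_n).
Hypothesis simple_e : simple_graph e.

Let D : 'M[R]_n := deg_mx R e.
Let A : 'M[R]_n := adj_mx R e.

Lemma deg_sum i : (deg e i)%:R = \sum_j (e i j)%:R :> R.
Proof.
rewrite /deg -sumr_const [LHS]big_mkcond; apply: eq_bigr => j _.
by rewrite inE; case: (e i j).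
Qed.

Lemma adj_mx_sym : A^T = A.
Proof. by have [sym_e _] := simple_e; apply/matrixP => i j; rewrite !mxE sym_e. Qed.

Lemma deg_mxE : D = diag_mx (\row_i (deg e i)%:R).
Proof.
apply/matrixP => i j; rewrite !mxE mulr_natl.
by case: eqP => [->|].
Qed.

Lemma trace_adj : \tr A = 0.
Proof.
have [_ irr_e] := simple_e.
by apply: big1 => i _; rewrite mxE irr_e.
Qed.

Lemma trace_adj_sq : \tr (A *m A) = \sum_i (deg e i)%:R.
Proof.
have [sym_e _] := simple_e.
apply: eq_bigr => i _; rewrite mxE deg_sum; apply: eq_bigr => j _.
by rewrite !mxE (sym_e j); case: (e i j); rewrite ?mulr1 ?mulr0.
Qed.

(** [A] only meets the entries of [M] between the colour classes; Cauchy-Schwarz is applied to these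
    and to [A], whose squared norm is the degree sum. *)
Lemma trace_adj_bipartite (c : pred 'I_n) (M : 'M[R]_n) :
  (forall i j, e i j -> c i != c j) -> orth_proj M ->
  2 * \tr (M *m A) ^+ 2 <= \tr M * \sum_i (deg e i)%:R.
Proof.
move=> proper_c pM; have [symM MM] := pM.
pose S : 'M[R]_n := diag_mx (\row_i (-1) ^+ c i).
pose a (x : 'I_n * 'I_n) := if c x.1 != c x.2 then M x.1 x.2 else 0.
pose b (x : 'I_n * 'I_n) := A x.1 x.2.
have -> : \tr (M *m A) = \sum_x a x * b x.
  rewrite -(pair_bigA _ (fun i j => a (i, j) * b (i, j))) /=.
  apply: eq_bigr => i _; rewrite mxE; apply: eq_bigr => j _.
  rewrite -adj_mx_sym mxE /a /b /= mxE.
  by case: (boolP (e i j)) => [/proper_c ->//|_]; rewrite !mulr0.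
have sum_b : \sum_x b x ^+ 2 = \sum_i (deg e i)%:R.
  rewrite -(pair_bigA _ (fun i j => b (i, j) ^+ 2)) /=.
  apply: eq_bigr => i _; rewrite deg_sum; apply: eq_bigr => j _.
  by rewrite /b mxE; case: (e i j); rewrite ?expr1n ?expr0n.
(* [M] being positive semidefinite, the blocks of [M] inside the two colour
   classes carry at least half of its Frobenius norm. *)
have sum_a : 2 * (\sum_x a x ^+ 2) <= \tr M.
  (* The trace of [N *m N] is the sum of the squared entries of [M], signed plus inside and minus
     between the colour classes. *)
  pose N := M *m S *m M.
  have symN : N^T = N by rewrite /N !trmx_mul symM tr_diag_mx mulmxA.
  have : 0 <= \tr (N *m N).
    apply: sumr_ge0 => i _; rewrite mxE; apply: sumr_ge0 => j _.
    by rewrite -{2}symN [X in _ * X]mxE -expr2 sqr_ge0.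
  have -> : \tr (N *m N) = \tr (M *m S *m (M *m S)).
    by rewrite /N mulmxA mxtrace_mulC !mulmxA MM -(mulmxA _ M M) MM.
  suff -> : \tr (M *m S *m (M *m S)) = \tr M - 2 * (\sum_x a x ^+ 2).
    by rewrite subr_ge0.
  have -> : \sum_x a x ^+ 2 = \sum_i \sum_j a (i, j) ^+ 2.
    by rewrite pair_bigA; apply: eq_bigr => -[].
  rewrite (orth_proj_trace pM).
  rewrite mulr_sumr -sumrB; apply: eq_bigr => i _.
  rewrite mxE mulr_sumr -sumrB; apply: eq_bigr => j _.
  rewrite !mul_mx_diag !mxE -{2}symM mxE /a /=.
  by case: (c i) (c j) => [] [] /=; rewrite ?expr0 ?expr1; ring.
have cs := cauchy_schwarz_sum a b.
apply: le_trans (_ : _ <= 2 * ((\sum_x a x ^+ 2) * (\sum_x b x ^+ 2))) _.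
  by rewrite ler_wpM2l.
rewrite mulrA sum_b ler_wpM2r //; apply: sumr_ge0 => i _; exact: ler0n.
Qed.

(** Cauchy-Schwarz on the neighbourhood of [v] gives [(l * u v)^2 <= deg v * q v], while the [q v]
    sum to [2 l]. Dividing by [deg v], summing and cancelling [l] gives the bound. *)
Lemma signless_eigenpair (u : 'I_n -> R) (l : R) :
  (forall v, 0 < deg e v)%N ->
  (forall v, \sum_j (e v j)%:R * (u v + u j) = l * u v) ->
  \sum_v u v ^+ 2 = 1 ->
  0 <= l /\ l * (\sum_v u v ^+ 2 / (deg e v)%:R) <= 2.
Proof.
move=> deg_gt0 eig_u unit_u; have [sym_e _] := simple_e.
pose q v := \sum_j (e v j)%:R * (u v + u j) ^+ 2.
have q_ge0 v : 0 <= q v.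
  by apply: sumr_ge0 => j _; rewrite mulr_ge0 ?ler0n ?sqr_ge0.
have sum_q : \sum_v q v = 2 * l.
  have half : \sum_v \sum_j (e v j)%:R * (u v + u j) * u v = l.
    rewrite -[RHS]mulr1 -[X in _ = _ * X]unit_u mulr_sumr; apply: eq_bigr => v _.
    by rewrite -mulr_suml eig_u -mulrA -expr2.
  (* Adding the double sum to its transpose turns the factor [u v] into [u v + u j]. *)
  rewrite mulr_natl mulr2n -{1}half -half [X in _ = _ + X]exchange_big -big_split.
  apply: eq_bigr => v _; rewrite -big_split; apply: eq_bigr => j _ /=.
  by rewrite (sym_e j); ring.
have l_ge0 : 0 <= l.
  by rewrite -(@pmulr_rge0 _ 2) // -sum_q; apply: sumr_ge0.
split=> //; have [->|l0] := eqVneq l 0; first by rewrite mul0r.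
have l_gt0 : 0 < l by rewrite lt0r l0.
rewrite -(ler_pM2l l_gt0) (mulrC l 2) -sum_q !mulr_sumr; apply: ler_sum => v _.
have dv : 0 < (deg e v)%:R :> R by rewrite ltr0n.
rewrite !mulrA ler_pdivrMr //.
have -> : l * l * u v * u v = (\sum_j (e v j)%:R * (u v + u j)) ^+ 2.
  by rewrite eig_u; ring.
have := cauchy_schwarz_sum (fun j => (e v j)%:R) (fun j => (e v j)%:R * (u v + u j)).
rewrite mulrC /q deg_sum; congr (_ ^+ 2 <= _ * _); apply: eq_bigr => j _.
- by case: (e v j); rewrite !(mul1r, mul0r).
- by case: (e v j); rewrite ?expr1n ?expr0n ?mul1r ?mul0r ?expr0n.
- by case: (e v j); rewrite ?expr1n ?expr0n.
Qed.

(* Writing [m_i = u_i M u_i^T] for an eigenbasis [(l_i, u_i)] of [D + A],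
   [\tr (M (D + A)) = \sum l_i m_i], and [l_i - 2] is at most
   [l_i u_i (1 - D^-1) u_i^T], which sums to [\tr ((D + A) (1 - D^-1))]. *)
Lemma trace_signless (M : 'M[R]_n) :
  (forall v, 0 < deg e v)%N -> orth_proj M ->
  \tr (M *m (D + A)) <= 2 * \tr M + \sum_v ((deg e v)%:R - 1).
Proof.
move=> deg_gt0 pM; have [sym_e irr_e] := simple_e.
set Q := D + A.
have symQ : Q^T = Q by rewrite /Q linearD /= adj_mx_sym deg_mxE tr_diag_mx.
have [P [d [PP Qd]]] := symmetric_diagonalization symQ.
pose m i := (P *m M *m P^T) i i.
have pPM := orth_proj_conj PP pM.
have eig i v : \sum_j (e v j)%:R * (P i v + P i j) = d 0 i * P i v.
  have : (P *m Q) i v = (diag_mx d *m P) i v.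
    by rewrite Qd !mulmxA PP mul1mx.
  rewrite mul_diag_mx [RHS]mxE => <-.
  rewrite /Q mulmxDr deg_mxE mul_mx_diag [RHS]mxE [X in _ = X + _]mxE mxE.
  rewrite [X in _ = _ + X]mxE deg_sum.
  rewrite mulr_sumr -big_split; apply: eq_bigr => j _ /=.
  by rewrite mxE (sym_e j) mulrDr; congr (_ + _); rewrite mulrC.
have unit_row i : \sum_v P i v ^+ 2 = 1.
  have /matrixP/(_ i i) := PP; rewrite [LHS]mxE [RHS]mxE eqxx => h; rewrite -[RHS]h.
  by apply: eq_bigr => v _; rewrite mxE expr2.
pose z i := \sum_v P i v ^+ 2 * (1 - (deg e v)%:R^-1).
have dz i : 0 <= d 0 i * z i /\ d 0 i - 2 <= d 0 i * z i.
  have [d_ge0 d_le] := signless_eigenpair deg_gt0 (eig i) (unit_row i).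
  have zE : z i = 1 - \sum_v P i v ^+ 2 / (deg e v)%:R.
    rewrite -[X in X - _](unit_row i) -sumrB; apply: eq_bigr => v _.
    by rewrite mulrBr mulr1.
  split; last by rewrite zE mulrBr mulr1 lerD2l lerN2.
  rewrite mulr_ge0 // sumr_ge0 // => v _; rewrite mulr_ge0 ?sqr_ge0 // subr_ge0.
  by rewrite invf_le1 ?ltr0n // ler1n.
have -> : \tr (M *m Q) = 2 * \tr M + \sum_i (d 0 i - 2) * m i.
  rewrite Qd mxtrace_diagonalized -(mxtrace_conj _ PP) mulr_sumr -big_split /=.
  by apply: eq_bigr => i _; rewrite /m; ring.
rewrite lerD2l.
apply: le_trans (_ : _ <= \sum_i d 0 i * z i) _.
  (* As [0 <= m i <= 1], one of the two bounds suffices according to the sign of [d 0 i - 2]. *)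
  apply: ler_sum => i _; have [dz0 dz2] := dz i.
  have := orth_proj_diag_ge0 i pPM; have := orth_proj_diag_le1 i pPM.
  by rewrite -/(m i); nra.
under eq_bigr do rewrite mulr_sumr.
rewrite exchange_big /=; apply: ler_sum => v _.
have QvE : \sum_i d 0 i * P i v ^+ 2 = (deg e v)%:R.
  have : Q v v = (deg e v)%:R by rewrite !mxE eqxx irr_e mul1r addr0.
  rewrite {1}Qd mul_mx_diag mxE => <-; apply: eq_bigr => i _.
  by rewrite !mxE; ring.
under eq_bigr do rewrite mulrA.
rewrite -mulr_suml QvE mulrBr mulr1 divff //.
by rewrite pnatr_eq0 -lt0n.
Qed.

(** Only the diagonal of [M] enters, and [deg v * m <= m + (deg v - 1)] whenever
    [m <= 1 <= deg v]. *)
Lemma trace_deg (M : 'M[R]_n) :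
  (forall v, 0 < deg e v)%N -> orth_proj M ->
  \tr (M *m D) <= \tr M + \sum_v ((deg e v)%:R - 1).
Proof.
move=> deg_gt0 pM.
rewrite deg_mxE /mxtrace -big_split; apply: ler_sum => v _ /=.
rewrite mul_mx_diag !mxE.
have : 1 <= (deg e v)%:R :> R by rewrite ler1n.
have := orth_proj_diag_ge0 v pM; have := orth_proj_diag_le1 v pM.
by nra.
Qed.
End GraphMatrices.

(** * Trees: trace bounds *)

Section TreeTraceBounds.
Variables (R : rcfType) (n : nat) (e : rel 'I_n) (M : 'M[R]_n).
Hypotheses (simple_e : simple_graph e) (tree_e : is_tree e) (pM : orth_proj M).

Lemma tree_sum_degR : \sum_i (deg e i)%:R <= 2 * (n%:R - 1) :> R.
Proof.
have [n0 _] := tree_e.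
have -> : n%:R - 1 = (n - 1)%N%:R :> R by rewrite natrB.
by rewrite -natr_sum -natrM ler_nat tree_sum_deg.
Qed.

Lemma tree_trace_adj : \tr (M *m adj_mx R e) ^+ 2 <= \tr M * (n%:R - 1).
Proof.
have [c proper_c] := tree_bipartite simple_e tree_e.
have := trace_adj_bipartite simple_e proper_c pM.
have : 0 <= \tr M by apply: sumr_ge0 => i _; apply: orth_proj_diag_ge0.
by have := tree_sum_degR; nra.
Qed.

(** The rank is at most twice the matching number and the degree sum at most [2 (n - 1)]; the two
    factors 2 cancel the 4 of [trace_sq_le_rank]. *)
Lemma tree_trace_adj_matching :
  \tr (M *m adj_mx R e) ^+ 2 <= (matching_number e)%:R * (n%:R - 1).
Proof.
have [sym_e _] := simple_e.
have [c proper_c] := tree_bipartite simple_e tree_e.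
have := trace_sq_le_rank (adj_mx_sym R simple_e) (trace_adj R simple_e) pM.
rewrite trace_adj_sq //.
have : (\rank (adj_mx R e))%:R <= 2 * (matching_number e)%:R :> R.
  by rewrite -natrM ler_nat (rank_adj_le_matching _ sym_e proper_c).
have := ler0n R (\rank (adj_mx R e)).
have : 0 <= n%:R - 1 :> R by have [n0 _] := tree_e; rewrite subr_ge0 ler1n.
by have := tree_sum_degR; nra.
Qed.

Lemma tree_trace_deg_signless : 1 <= \tr M ->
  \tr (M *m deg_mx R e) <= n%:R + 2 * \tr M - 2 /\
  \tr (M *m deg_mx R e) + \tr (M *m adj_mx R e) <= n%:R + 2 * \tr M - 2.
Proof.
move=> trM; have [n0 _] := tree_e; have sum_deg := tree_sum_degR.
have [n1|n1] := ltnP 1 n.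
  have deg_gt0 v := tree_deg_gt0 tree_e v n1.
  have := trace_signless simple_e deg_gt0 pM.
  rewrite mulmxDr mxtraceD.
  have := trace_deg deg_gt0 pM; rewrite sumrB sumr_const card_ord.
  by split; lra.
(* A single vertex has degree 0: both traces vanish, and [1 <= \tr M] makes the bound
   nonnegative. *)
have nE : n%:R = 1 :> R by have -> : n = 1%N by apply/eqP; rewrite eqn_leq n1.
have y0 : \tr (M *m adj_mx R e) = 0.
  apply/eqP; rewrite -sqrf_eq0 eq_le sqr_ge0 andbT.
  by have := tree_trace_adj; rewrite nE subrr mulr0.
have x0 : \tr (M *m deg_mx R e) = 0.
  rewrite deg_mxE /mxtrace big1 // => i _; rewrite mul_mx_diag !mxE.
  suff -> : deg e i = 0%N by rewrite mulr0.
  apply/eqP; rewrite -leqn0.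
  have := tree_sum_deg simple_e tree_e.
  by rewrite (eqP n1) muln0; apply: leq_trans; rewrite (bigD1 i) //= leq_addr.
by rewrite x0 y0 nE; split; lra.
Qed.
End TreeTraceBounds.

(** * Combination of the trace bounds *)

Theorem theorem4p2 (R : rcfType) (n : nat) (e : rel 'I_n) (alpha : R)
  (s : seq R) (k : nat) :
  simple_graph e -> is_tree e ->
  0 <= alpha < 1 ->
  is_spectrum (A_alpha e alpha) s ->
  (1 <= k <= n)%N ->
  let beta := matching_number e in
  (alpha < 1 / 2 ->
     Sk s k <= alpha * (n%:R + 2 * k%:R - 2) + (1 - 2 * alpha) *
       (if (k <= beta)%N then Num.sqrt (k%:R * (n%:R - 1))
        else if (k <= n - beta)%N then Num.sqrt (beta%:R * (n%:R - 1))
        else Num.sqrt ((n - k)%:R * (n%:R - 1))))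
  /\
  (1 / 2 <= alpha -> Sk s k <= alpha * (n%:R + 2 * k%:R - 2)).
Proof.
move=> simple_e tree_e /andP[a0 a1] [_ chi] /andP[k1 kn] beta.
have sym_Aa : (A_alpha e alpha)^T = A_alpha e alpha.
  by rewrite /A_alpha linearD !linearZ /= adj_mx_sym // deg_mxE tr_diag_mx.
have [M [pM trM ->]] := Sk_orth_proj sym_Aa chi kn.
have -> : \tr (M *m A_alpha e alpha) =
    alpha * \tr (M *m deg_mx R e) + (1 - alpha) * \tr (M *m adj_mx R e).
  by rewrite /A_alpha mulmxDr -!scalemxAr mxtraceD !mxtraceZ.
have trM1 : 1 <= \tr M by rewrite trM ler1n.
have := tree_trace_deg_signless simple_e tree_e pM trM1.
have := tree_trace_adj simple_e tree_e pM.
have := tree_trace_adj_matching simple_e tree_e pM.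
(* [1 - M] has trace [n - k] and gives the same trace against [A] up to sign: this is the bound used
   for [k > n - beta]. *)
have := tree_trace_adj simple_e tree_e (orth_proj_compl pM).
rewrite mulmxBl mul1mx !mxtraceD !(raddfN mxtrace) /= trace_adj // sub0r sqrrN mxtrace1 trM -natrB //.
set x := \tr (M *m deg_mx R e); set y := \tr (M *m adj_mx R e).
(* For [1 / 2 <= alpha], the trace is [(2 alpha - 1) x + (1 - alpha) (x + y)], whose weights are
   nonnegative and sum to [alpha]. *)
move=> y_co y_match y_k [x_le xy_le]; split=> a_half; last by nra.
have le_sqrt z : y ^+ 2 <= z -> y <= Num.sqrt z.
  by move=> yz; apply: le_trans (ler_norm _) _; rewrite -sqrtr_sqr ler_wsqrtr.
have -> : alpha * x + (1 - alpha) * y = alpha * (x + y) + (1 - 2 * alpha) * y by ring.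
apply: lerD; first exact: ler_wpM2l.
apply: ler_wpM2l; first by lra.
by case: ifP => _; [|case: ifP => _]; apply: le_sqrt.
Qed.
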